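(* There is a pair of unbiased (real) Hadamard matrices of order $36$; that is, there exist two Hadamard matrices $H,K$ of order $36$ such that every entry of $HK^t$ has absolute value $6$.
   Context: A Hadamard matrix of order $m$ is an $m\times m$ matrix with all entries in $\{1,-1\}$ and pairwise orthogonal rows (so $HH^t=mI$). Two Hadamard matrices $H,K$ of order $m$ are called unbiased if every entry of $HK^t$ has absolute value $\sqrt{m}$. *)

(* Defs.v *)
From mathcomp Require Import all_boot all_order all_algebra.
Set Implicit Arguments.
Unset Strict Implicit.
Unset Printing Implicit Defensive.
Import Order.TTheory GRing.Theory Num.Theory.
Local Open Scope ring_scope.

Definition hadamard (R : rcfType) (m : nat) (H : 'M[R]_m) : Prop :=
  (forall i j, H i j = 1 \/ H i j = -1) /\
  (forall i k, i != k -> \sum_(j < m) H i j * H k j = 0).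

(* Only the condition on the product; it is meant for H and K Hadamard, which
   is required separately. *)
Definition unbiased (R : rcfType) (m : nat) (H K : 'M[R]_m) : Prop :=
  forall i j, `|(H *m K^T) i j| = Num.sqrt (m%:R).

Lemma hadamard_mul_tr (R : rcfType) (m : nat) (H : 'M[R]_m) :
  hadamard H -> H *m H^T = (m%:R)%:M.
Proof.
case=> Hpm Horth; apply/matrixP=> i k; rewrite !mxE.
under eq_bigr do rewrite mxE.
case: (eqVneq i k) => [<-|/Horth //].
rewrite (eq_bigr (fun=> 1)); first by rewrite sumr_const card_ord.
by move=> j _; case: (Hpm i j) => ->; rewrite ?mulrNN mulr1.
Qed.

(* Main.v *)
Require Import Defs.
From mathcomp Require Import all_boot all_order all_algebra.
From mathcomp Require Import ring.
Set Implicit Arguments.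
Unset Strict Implicit.
Unset Printing Implicit Defensive.
Import Order.TTheory GRing.Theory Num.Theory.
Local Open Scope ring_scope.

(** Quaternions act on themselves by 4 x 4 real matrices, so four square blocks
    [a, b, c, d] of order [n], read as the quaternion [a + b i + c j + d k] with
    matrix coefficients, give a matrix of order [4 n], the Williamson array.
    Products of arrays are quaternion products, and for symmetric blocks
    transposition is quaternion conjugation.  Everything therefore happens in a
    quaternion algebra over an algebra of matrices of order 9.

    The blocks come from the affine plane of order 3.  Each of its four classes
    of parallel lines partitions the nine points; let [P_m] have entry [1] at
    two points on a common line of class [m] and [-1] elsewhere, and let [J] be
    the all-ones matrix.  Lines of different classes meet in one point, which
    gives [P_m P_n = J] for [m <> n]; lines have three points, which gives
    [P_m ^ 2 = 6 P_m + 3 J]; two distinct points lie on exactly one line, which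
    gives [P_0 + P_1 + P_2 + P_3 = 6 I - 2 J].  Hence the four squares add up to
    [36 I], so by Williamson's theorem
    [H = P_0 + P_1 i + P_2 j + P_3 k] and [K = P_0 - P_2 i - P_3 j - P_1 k]
    are Hadamard matrices.  The cyclic shift of the imaginary blocks is chosen
    so that every coefficient of [H K^T] is, up to sign, one square minus three
    mixed products, i.e. [P_m ^ 2 - 3 J = 6 P_m]: precisely,
    [H K^T = 6 (P_0 - P_3 i - P_1 j - P_2 k)], all of whose entries are
    [6] or [-6]. *)

(** * Sign matrices *)

Definition sign_mx (R : pzRingType) p q (A : 'M[R]_(p, q)) : Prop :=
  forall i j, A i j = 1 \/ A i j = -1.

Lemma sign_mxN (R : pzRingType) p q (A : 'M[R]_(p, q)) :
  sign_mx A -> sign_mx (- A).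
Proof. by move=> sA i j; rewrite mxE; case: (sA i j) => ->; rewrite ?opprK; auto. Qed.

Lemma sign_mx_block (R : pzRingType) p1 p2 q1 q2
    (A : 'M[R]_(p1, q1)) (B : 'M[R]_(p1, q2))
    (C : 'M[R]_(p2, q1)) (D : 'M[R]_(p2, q2)) :
  sign_mx A -> sign_mx B -> sign_mx C -> sign_mx D ->
  sign_mx (block_mx A B C D).
Proof.
move=> sA sB sC sD i j; rewrite mxE.
by case: (split i) => i'; rewrite mxE; case: (split j).
Qed.

Lemma sign_mx_hadamard (R : rcfType) m (A : 'M[R]_m) :
  sign_mx A -> A *m A^T = (m%:R)%:M -> hadamard A.
Proof.
move=> sA AAt; split=> // i k neq_ik.
have := congr1 (fun B : 'M_m => B i k) AAt.
rewrite !mxE (negPf neq_ik) mulr0n => AAt0; rewrite -[RHS]AAt0.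
by apply: eq_bigr => j _; rewrite mxE.
Qed.

(** * Williamson arrays *)

(** The matrix of right multiplication by [a + b i + c j + d k] on the basis
    [1, i, j, k], whose first row therefore lists the coefficients. *)
Definition williamson (R : pzRingType) n (a b c d : 'M[R]_n) :
    'M[R]_(n + n + (n + n)) :=
  block_mx (block_mx a b (- b) a) (block_mx c d (- d) c)
           (block_mx (- c) d (- d) (- c)) (block_mx a (- b) b a).

(** This is the quaternion product.  No commutation between blocks is required,
    since quaternion units commute with the coefficients. *)
Lemma williamson_mul (R : comPzRingType) n (a b c d e f g h : 'M[R]_n) :
  williamson a b c d *m williamson e f g h =
  williamson (a *m e - b *m f - c *m g - d *m h)
             (a *m f + b *m e + c *m h - d *m g)
             (a *m g - b *m h + c *m e + d *m f)
             (a *m h + b *m g - c *m f + d *m e).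
Proof.
rewrite /williamson !mulmx_block !add_block_mx !mulmxN !mulNmx !opprK.
(* With the sixteen block products opaque, only additive identities remain. *)
move: (a *m e) (a *m f) (a *m g) (a *m h) (b *m e) (b *m f) (b *m g) (b *m h).
move: (c *m e) (c *m f) (c *m g) (c *m h) (d *m e) (d *m f) (d *m g) (d *m h).
move=> ce cf cg ch de df dg dh ae af ag ah be bf bg bh.
by congr block_mx; congr block_mx; apply/matrixP=> i j; rewrite !mxE; ring.
Qed.

Lemma williamson_tr (R : pzRingType) n (a b c d : 'M[R]_n) :
  a^T = a -> b^T = b -> c^T = c -> d^T = d ->
  (williamson a b c d)^T = williamson a (- b) (- c) (- d).
Proof.
by move=> aT bT cT dT; rewrite /williamson !tr_block_mx !raddfN /= aT bT cT dT !opprK.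
Qed.

Lemma williamson_scalar (R : pzRingType) n (x : R) :
  williamson (x%:M : 'M_n) 0 0 0 = x%:M.
Proof. by rewrite /williamson !oppr0 !block_mx0 -!scalar_mx_block. Qed.

(** Williamson's theorem.  The Gram matrix is the quaternion norm: commuting blocks cancel in pairs in
    the imaginary coefficients. *)
Lemma williamson_hadamard (R : rcfType) n (a b c d : 'M[R]_n) :
  sign_mx a -> sign_mx b -> sign_mx c -> sign_mx d ->
  a^T = a -> b^T = b -> c^T = c -> d^T = d ->
  comm_mx a b -> comm_mx a c -> comm_mx a d ->
  comm_mx b c -> comm_mx b d -> comm_mx c d ->
  a *m a + b *m b + c *m c + d *m d = ((n + n + (n + n))%:R)%:M ->
  hadamard (williamson a b c d).
Proof.
move=> sa sb sc sd aT bT cT dT ab ac ad bc bd cd norm.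
apply: sign_mx_hadamard.
  by apply: sign_mx_block; apply: sign_mx_block => //; apply: sign_mxN.
rewrite williamson_tr // williamson_mul !mulmxN !opprK norm ab ac ad bc bd cd.
rewrite addNr sub0r addNr (addrAC (- (c *m a))) addNr add0r addrN subrK addNr.
exact: williamson_scalar.
Qed.

(** * The four parallel classes of the affine plane of order 3 *)

(** The point [p < 9] has coordinates [(p %/ 3, p %% 3)] over the field with
    three elements, and [p] is congruent to its second coordinate.  The class
    [m < 3] consists of the lines [y + m x = constant], the class [m = 3] of the
    lines [x = constant]. *)
Definition collinear (m p q : nat) : bool :=
  (if m == 3 then p %/ 3 == q %/ 3
   else p + m * (p %/ 3) == q + m * (q %/ 3) %[mod 3])%N.

Definition plane_sign (m p q : nat) : int := if collinear m p q then 1 else -1.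

Definition plane_mx (R : pzRingType) (m : nat) : 'M[R]_9 :=
  \matrix_(p, q) (plane_sign m p q)%:~R.

(** With [L m] the incidence matrix of collinearity in class [m], the matrix of
    the signs is [2 L m - J]; each row of [L m] has three ones, [L m ^ 2 = 3 L m],
    and [L m1 *m L m2 = J] for different classes since their lines meet once.
    Expanding gives both cases.  The plane is so small that enumeration over the
    integers settles them at once. *)
Lemma plane_sum_mul m1 m2 p q :
  (m1 < 4)%N -> (m2 < 4)%N -> (p < 9)%N -> (q < 9)%N ->
  \sum_(k < 9) plane_sign m1 p k * plane_sign m2 k q =
    if m1 == m2 then 6 * plane_sign m1 p q + 3 else 1.
Proof.
have check : all (fun m1 => all (fun m2 => all (fun p => all (fun q =>
    foldr +%R 0 [seq plane_sign m1 p k * plane_sign m2 k q | k <- iota 0 9] ==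
    if m1 == m2 then 6 * plane_sign m1 p q + 3 else 1)
    (iota 0 9)) (iota 0 9)) (iota 0 4)) (iota 0 4) by vm_compute.
move=> m1_lt m2_lt p_lt q_lt.
move/allP/(_ m1): check; rewrite mem_iota => /(_ m1_lt).
move/allP/(_ m2); rewrite mem_iota => /(_ m2_lt).
move/allP/(_ p); rewrite mem_iota => /(_ p_lt).
move/allP/(_ q); rewrite mem_iota => /(_ q_lt) /eqP <-.
rewrite -(big_mkord xpredT (fun k => plane_sign m1 p k * plane_sign m2 k q)).
by rewrite foldrE big_map.
Qed.

(** A pair of distinct points has sign [1] for the class of its joining line and
    [-1] for the other three; a point with itself has sign [1] four times. *)
Lemma plane_sum p q : (p < 9)%N -> (q < 9)%N ->
  plane_sign 0 p q + plane_sign 1 p q + plane_sign 2 p q + plane_sign 3 p q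
  = 6 * (p == q)%:R - 2.
Proof.
have check : all (fun p => all (fun q =>
    plane_sign 0 p q + plane_sign 1 p q + plane_sign 2 p q + plane_sign 3 p q ==
    6 * (p == q)%:R - 2) (iota 0 9)) (iota 0 9) by vm_compute.
move=> p_lt q_lt.
move/allP/(_ p): check; rewrite mem_iota => /(_ p_lt).
by move/allP/(_ q); rewrite mem_iota => /(_ q_lt) /eqP.
Qed.

Lemma plane_mx_tr (R : pzRingType) m : (plane_mx R m)^T = plane_mx R m.
Proof.
apply/matrixP=> p q; rewrite !mxE /plane_sign /collinear.
by rewrite (eq_sym (q %/ 3)%N) (eq_sym (_ %% 3)%N).
Qed.

Lemma plane_mx_sign (R : pzRingType) m : sign_mx (plane_mx R m).
Proof. by move=> p q; rewrite mxE /plane_sign; case: ifP; rewrite ?mulrN1z; auto. Qed.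

Lemma plane_mx_mul (R : pzRingType) m1 m2 : (m1 < 4)%N -> (m2 < 4)%N ->
  plane_mx R m1 *m plane_mx R m2 =
    if m1 == m2 then 6 *: plane_mx R m1 + const_mx 3 else const_mx 1.
Proof.
move=> m1_lt m2_lt; apply/matrixP=> p q; rewrite mxE.
under eq_bigr do rewrite !mxE -intrM.
rewrite -rmorph_sum plane_sum_mul //.
by case: ifP => _; rewrite !mxE // rmorphD rmorphM.
Qed.

Lemma plane_mx_sum (R : pzRingType) :
  plane_mx R 0 + plane_mx R 1 + plane_mx R 2 + plane_mx R 3 =
  6%:M - const_mx 2.
Proof.
apply/matrixP=> p q; rewrite !mxE -!rmorphD plane_sum //.
by rewrite -[(p : nat) == q]/(p == q); case: (p == q); rewrite ?mulr1 ?mulr0 rmorphB.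
Qed.

Lemma plane_mx_norm (R : comPzRingType) :
  plane_mx R 0 *m plane_mx R 0 + plane_mx R 1 *m plane_mx R 1 +
  plane_mx R 2 *m plane_mx R 2 + plane_mx R 3 *m plane_mx R 3 = 36%:M.
Proof.
have -> : 36%:M = 6 *: (6%:M - const_mx 2) + const_mx 12 :> 'M[R]_9.
  by apply/matrixP=> p q; rewrite !mxE; case: (p == q); ring.
rewrite -plane_mx_sum !plane_mx_mul //=.
by apply/matrixP=> p q; rewrite !mxE; ring.
Qed.

Lemma plane_mx_comm (R : pzRingType) m1 m2 : (m1 < 4)%N -> (m2 < 4)%N ->
  comm_mx (plane_mx R m1) (plane_mx R m2).
Proof.
move=> m1_lt m2_lt; rewrite /comm_mx !plane_mx_mul // [m2 == m1]eq_sym.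
by case: eqP => [->|].
Qed.

(** * The unbiased pair *)

Theorem corollary17 (R : rcfType) :
  exists H K : 'M[R]_36,
    [/\ hadamard H, hadamard K, unbiased H K
      & forall i j : 'I_36, `|(H *m K^T) i j| = 6].
Proof.
pose P := plane_mx R.
pose H := williamson (P 0) (P 1) (P 2) (P 3).
pose K := williamson (P 0) (- P 2) (- P 3) (- P 1).
pose L := williamson (P 0) (- P 3) (- P 1) (- P 2).
have sP m : sign_mx (P m) by exact: plane_mx_sign.
have sNP m : sign_mx (- P m) by exact/sign_mxN.
have PT m : (P m)^T = P m by exact: plane_mx_tr.
have NPT m : (- P m)^T = - P m by rewrite raddfN /= PT.
have HH : hadamard H.
  by apply: williamson_hadamard => //; [exact: plane_mx_comm.. | exact: plane_mx_norm].
have HK : hadamard K.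
  apply: williamson_hadamard => //;
    try by do ?[apply: comm_mxN | apply/comm_mx_sym/comm_mxN/comm_mx_sym];
           exact: plane_mx_comm.
  (* The squares come in the order 0, 2, 3, 1. *)
  rewrite !mulNmx !mulmxN !opprK -!addrA [X in _ + X]addrA [X in _ + X]addrC !addrA.
  exact: plane_mx_norm.
(* Each coefficient is a square [6 P m + 3 J] against three products [J]. *)
have HKL : H *m K^T = 6 *: L.
  rewrite williamson_tr // !opprK williamson_mul !plane_mx_mul //=.
  rewrite /L /williamson !scale_block_mx.
  by congr block_mx; congr block_mx; apply/matrixP=> p q; rewrite !mxE; ring.
have sL : sign_mx L by do 2! apply: sign_mx_block => //; rewrite ?opprK.
have abs6 i j : `|(H *m K^T) i j| = 6.
  by rewrite HKL mxE normrM; case: (sL i j) => ->; rewrite ?normrN normr1 mulr1 ger0_norm.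
exists H, K; split => // i j.
have -> : 36%:R = 6 ^+ 2 :> R by ring.
by rewrite abs6 sqrtr_sqr ger0_norm.
Qed.
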